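(* There is an absolute constant $C$ such that for every finite connected simple graph $G$ with $n$ vertices, minimum degree $\delta$ and maximum degree $\Delta$, and every choice of rotor sequence lengths with parameter $\tilde\kappa$, \[ \widetilde{\mathsf{EC}}(G)\le C\Big(\frac{\Delta}{\delta}\cdot\frac{n}{1-\lambda_2(\mathbf{P})}+n\,\tilde\kappa\,\frac{\Delta}{\delta}\cdot\frac{\Delta\log n}{1-\lambda_2(\mathbf{P})}\Big). \]
   Context: $\mathbf{P}$ is the simple random walk on $G$ ($\mathbf{P}_{u,v}=1/\deg(u)$ for $\{u,v\}\in E$) and $\lambda_2(\mathbf{P})$ is its second largest eigenvalue in absolute value. Unweighted deterministic walk: each vertex $u$ has a rotor sequence $(\tilde s(u,1),\dots,\tilde s(u,\tilde d(u)))$ of neighbours of $u$ in which every neighbour occurs exactly $\tilde d(u)/\deg(u)$ times, and an initial rotor position $\tilde r_0(u)\in\{1,\dots,\tilde d(u)\}$; $\tilde\kappa=\max_u\tilde d(u)/\deg(u)$ (lengths $\tilde d$ fixed). From start $\tilde x_0$, $\tilde x_{t+1}=\tilde s(\tilde x_t,\tilde r_t(\tilde x_t))$, $\tilde r_{t+1}(\tilde x_t)=(\tilde r_t(\tilde x_t)\bmod \tilde d(\tilde x_t))+1$, other rotors unchanged. A configuration is the choice of rotor sequences and initial rotor positions. $\widetilde{\mathsf{EC}}(G)$ is the maximum over start vertices and configurations of the least $t$ with $\{\{\tilde x_{\ell-1},\tilde x_\ell\}:1\le\ell\le t\}=E$. Logarithms are base 2. *)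

(* Defs.v *)
From mathcomp Require Export all_boot all_order all_algebra.
From mathcomp Require Export all_classical all_reals all_analysis.
From mathcomp Require Export complex.

Set Implicit Arguments.
Unset Strict Implicit.
Unset Printing Implicit Defensive.

Import Order.TTheory GRing.Theory Num.Theory.

Local Open Scope ring_scope.

(* A simple graph is a symmetric irreflexive relation [e] on a finite type;
   it is passed as the relation alone. *)
Section Graph.
Variables (T : finType) (e : rel T).

Definition connected_graph : Prop :=
  (0 < #|T|)%N /\ forall x y : T, connect e x y.

Definition deg (u : T) : nat := #|[pred v | e u v]|.

(* [deg u < #|T|] for every vertex, so the default value #|T| of the minimum
   is only taken when there is no vertex. *)
Definition min_deg : nat := \big[minn/#|T|]_(u : T) deg u.

Definition max_deg : nat := \max_(u : T) deg u.

Definition edge_set : {set {set T}} :=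
  [set [set p.1; p.2] | p in [pred p : T * T | e p.1 p.2]]%SET.

End Graph.

Section Spectrum.
Variables (R : realType).

(* The eigenvalues, i.e. the roots of the characteristic polynomial, listed
   with their algebraic multiplicities. *)
Definition eigenvalues (n : nat) (A : 'M[R[i]]_n) : seq R[i] :=
  sval (closed_field_poly_normal (char_poly A)).

Definition srw_matrix (T : finType) (e : rel T) : 'M[R]_#|T| :=
  \matrix_(i, j) (if e (enum_val i) (enum_val j)
                  then (deg e (enum_val i))%:R^-1 else 0).

(* The moduli are sorted in decreasing order with multiplicity; index 0 is the
   largest one.  In particular the value is 1 when the graph is bipartite. *)
Definition lambda2 (T : finType) (e : rel T) : R :=
  let P := map_mx (real_complex R) (srw_matrix e) in
  nth 0 (sort >=%R [seq Normc.normc z | z <- eigenvalues P]) 1.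

End Spectrum.

Section RotorWalk.
Variables (T : finType) (e : rel T) (d : T -> nat).

Definition rotor_lists := {dffun forall u : T, (d u).-tuple T}.

(* Positions are numbered from 0 to [d u - 1] instead of from 1 to [d u], so
   that the cyclic successor on positions is [ordS]. *)
Definition rotor_positions := {dffun forall u : T, 'I_(d u)}.

(* If [deg e u] does not divide [d u], no list satisfies this. *)
Definition rotor_sequences (s : rotor_lists) : bool :=
  [forall u : T, forall v : T,
     count_mem v (s u) == (if e u v then d u %/ deg e u else 0)%N].

Definition walk_step (s : rotor_lists) (c : T * rotor_positions) :
    T * rotor_positions :=
  (tnth (s c.1) (c.2 c.1),
   [ffun v : T => if v == c.1 then ordS (c.2 v) else c.2 v]).

Definition walk (s : rotor_lists) (r0 : rotor_positions) (x0 : T) (t : nat) :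
    T :=
  (iter t (walk_step s) (x0, r0)).1.

Definition traversed (s : rotor_lists) (r0 : rotor_positions) (x0 : T)
    (t : nat) : {set {set T}} :=
  [set [set walk s r0 x0 l; walk s r0 x0 l.+1] | l : 'I_t]%SET.

Variable R : realType.

(* The least [t] at which every edge has been traversed; it is +oo if there
   is no such [t]. *)
Definition edge_cover_time (s : rotor_lists) (r0 : rotor_positions) (x0 : T) :
    \bar R :=
  ereal_inf [set (t%:R)%:E | t in
    [set t : nat | traversed s r0 x0 t = edge_set e]%classic]%classic.

Definition max_edge_cover_time : \bar R :=
  \big[maxe/0%E]_(x0 : T)
    \big[maxe/0%E]_(s : rotor_lists | rotor_sequences s)
      \big[maxe/0%E]_(r0 : rotor_positions) edge_cover_time s r0 x0.

Definition kappa : R := \big[Num.max/0]_(u : T) ((d u)%:R / (deg e u)%:R).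

End RotorWalk.

Definition log2 (R : realType) (x : R) : R := ln x / ln 2.

(* Main.v *)
Require Import Defs.
From mathcomp Require Import mxred spectral ring lra.

(* Let a(u) = N(u) / deg(u), where N(u) is the number of exits from u up to time
   t.  Each full turn of the rotor at v crosses every edge at v equally often,
   so v -> u is crossed at least a(v) - kappa times, and u is entered at most
   N(u) + 1 times; hence P a <= a + 2 kappa pointwise.  Iterating,
   P^k a <= a + 2 k kappa.  Once P^k(u,v) >= pi(v)/2 for all u, v, the left-hand
   side is at least t / (2 W) with W the sum of the degrees, so that
   t >= 2 W (2k + 1) kappa forces a >= kappa: every rotor has made a full turn
   and every edge is covered.
   By reversibility tr(P^(2k)) - 1 is a weighted sum of the squares
   (P^k(u,v) - pi(v))^2, and the trace is the power sum of the eigenvalues, so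
   it is at most 1 + n lambda_2^(2k); hence k = O(log n / (1 - lambda_2)) steps
   suffice. *)

Set Implicit Arguments.
Unset Strict Implicit.
Unset Printing Implicit Defensive.

Import Order.TTheory GRing.Theory Num.Theory.

(** * Rotor walks *)

(** Moving the window by one drops [f r] and gains [f (r + p)], which are equal. *)
Lemma sum_periodic_shift (f : nat -> nat) p r : (forall j, f (j + p)%N = f j) ->
  (\sum_(j < p) f (r + j) = \sum_(j < p) f j)%N.
Proof.
move=> fp; elim: r => [//|r IH]; apply/eqP.
rewrite -IH -(eqn_add2r (f r)) -[in X in _ == X](fp r) -(big_ord_recr p (fun j => f (r + j)%N)).
rewrite big_ord_recl /= addn0 addnC; apply/eqP; congr (_ + _)%N.
by apply: eq_bigr => j _; rewrite addSnnS.
Qed.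

Lemma sum_periodic (f : nat -> nat) p q r : (forall j, f (j + p)%N = f j) ->
  (\sum_(j < q * p) f (r + j) = q * \sum_(j < p) f j)%N.
Proof.
move=> fp; elim: q r => [|q IH] r; first by rewrite big_ord0.
rewrite mulSn big_split_ord /= mulSn sum_periodic_shift //; congr (_ + _)%N.
by rewrite -(IH (r + p)%N); apply: eq_bigr => j _; rewrite addnA.
Qed.

Lemma sum_count_mem (T : finType) (s : seq T) : (\sum_v count_mem v s = size s)%N.
Proof.
elim: s => [|x s IH] /=; first by rewrite big1.
rewrite big_split /= IH (bigD1 x) //= eqxx big1 ?addn0 // => v vx.
by rewrite eq_sym (negPf vx).
Qed.

Section Walk.
Variables (T : finType) (e : rel T) (d : T -> nat).
Variables (s : rotor_lists d) (r0 : rotor_positions d) (x0 : T).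
Hypothesis rotor_s : rotor_sequences e s.

Local Notation x := (walk s r0 x0).

Definition exits (u : T) (t : nat) : nat := (\sum_(l < t) (x l == u))%N.

Definition crossings (u v : T) (t : nat) : nat :=
  (\sum_(l < t) ((x l == u) && (x l.+1 == v)))%N.

Lemma count_rotor u v : count_mem v (s u) = if e u v then (d u %/ deg e u)%N else 0%N.
Proof. by have /forallP/(_ u)/forallP/(_ v)/eqP := rotor_s. Qed.

(** The initial position [r0 u] is an element of ['I_(d u)], which is therefore inhabited. *)
Lemma rotor_pos_lengths u : (0 < d u)%N.
Proof. by case: (r0 u) => m; case: (d u). Qed.

(** Counting the entries of [s u] by value shows that the truncated quotient in [rotor_sequences] is
    exact. *)
Lemma rotor_length u : d u = (d u %/ deg e u * deg e u)%N.
Proof.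
rewrite -[LHS](size_tuple (s u)) -sum_count_mem.
under eq_bigr do rewrite count_rotor.
by rewrite -big_mkcond /= sum_nat_const mulnC; congr (_ * _)%N; apply: eq_card.
Qed.

Lemma multiplicity_gt0 u : (0 < d u %/ deg e u)%N.
Proof. by have := rotor_pos_lengths u; rewrite {1}rotor_length muln_gt0 => /andP[]. Qed.

Lemma rotor_position t u :
  nat_of_ord ((iter t (walk_step s) (x0, r0)).2 u) = ((r0 u + exits u t) %% d u)%N.
Proof.
elim: t => [|t IH]; first by rewrite /exits big_ord0 addn0 modn_small.
rewrite /exits big_ord_recr /= -/(exits u t) ffunE -/(walk s r0 x0 t) eq_sym.
case: eqP => _ /=; last by rewrite addn0.
by rewrite IH -[in LHS]addn1 modnDml addnA.
Qed.

Lemma walkS t : x t.+1 = nth x0 (s (x t)) ((r0 (x t) + exits (x t) t) %% d (x t)).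
Proof. by rewrite {1}/walk /= (tnth_nth x0) rotor_position. Qed.

Lemma walk_edge t : e (x t) (x t.+1).
Proof.
have : x t.+1 \in tval (s (x t)) by rewrite {1}/walk /= mem_tnth.
by rewrite -has_pred1 has_count count_rotor; case: ifP.
Qed.

(** Exit number [j] from [u], counted from 0, uses the rotor entry at [(r0 u + j) %% d u]; so
    crossings depend on [t] only through [exits u t]. *)
Lemma crossings_exits u v t : crossings u v t =
  (\sum_(j < exits u t) (nth x0 (s u) ((r0 u + j) %% d u) == v))%N.
Proof.
elim: t => [|t IH]; first by rewrite /crossings /exits !big_ord0.
rewrite /crossings /exits !big_ord_recr /= -/(crossings u v t) -/(exits u t).
case: eqP => [xu|_] /=; last by rewrite !addn0.
by rewrite addn1 big_ord_recr /= IH walkS xu.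
Qed.

(* Each full turn of the rotor at u crosses (u, v) the same number of times. *)
Lemma crossings_ge u v t :
  (exits u t %/ d u * count_mem v (s u) <= crossings u v t)%N.
Proof.
pose f j := (nth x0 (s u) (j %% d u) == v) : nat.
have -> : count_mem v (s u) = (\sum_(j < d u) f j)%N.
  rewrite -sum1_count big_mkcond /= big_tuple.
  apply: eq_bigr => j _; rewrite /f modn_small // (tnth_nth x0).
  by case: (_ == v).
(* The turns start at [r0 u] instead of 0, which periodicity makes harmless. *)
rewrite -(@sum_periodic f (d u) _ (r0 u)); last by move=> j; rewrite /f modnDr.
rewrite crossings_exits [in leqRHS](divn_eq (exits u t) (d u)) big_split_ord /=.
exact: leq_addr.
Qed.

(** Division-free form of exits / deg <= crossings + d / deg: [crossings_ge] accounts for the full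
    turns, and the incomplete turn has fewer than [d u] exits. *)
Lemma exits_le u v t : e u v ->
  (exits u t <= (crossings u v t + d u %/ deg e u) * deg e u)%N.
Proof.
move=> euv; have := crossings_ge u v t; rewrite count_rotor euv => le_c.
rewrite [leqLHS](divn_eq _ (d u)) mulnDl -rotor_length leq_add //.
  by rewrite [X in (_ * X)%N]rotor_length mulnA leq_mul.
by rewrite ltnW // ltn_mod rotor_pos_lengths.
Qed.

(** Each entry into [v] before time [t] is followed by an exit; an entry at time [t] itself accounts
    for the successor. *)
Lemma sum_crossings_le v t : (\sum_u crossings u v t <= (exits v t).+1)%N.
Proof.
rewrite /crossings exchange_big /=.
have -> : (\sum_(l < t) \sum_u ((x l == u) && (x l.+1 == v)) = \sum_(l < t) (x l.+1 == v))%N.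
  apply: eq_bigr => l _; rewrite (bigD1 (x l)) //= eqxx big1 ?addn0 // => u.
  by rewrite eq_sym => /negPf->.
apply: (@leq_trans (exits v t.+1)).
  by rewrite /exits big_ord_recl /= leq_addl.
by rewrite /exits big_ord_recr /= -addn1 leq_add2l leq_b1.
Qed.

Lemma sum_exits t : (\sum_u exits u t = t)%N.
Proof.
rewrite /exits exchange_big /= -[RHS]card_ord -sum1_card.
apply: eq_bigr => l _; rewrite (bigD1 (x l)) //= eqxx big1 // => u.
by rewrite eq_sym => /negPf->.
Qed.

Lemma traversed_edge_set t : (forall u, (d u <= exits u t)%N) ->
  traversed s r0 x0 t = edge_set e.
Proof.
move=> full; apply/setP => E; apply/imsetP/imsetP => [[l _ ->]|[[u v] /= + ->]].
  by exists (x l, x l.+1) => //; exact: walk_edge.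
rewrite inE /= => euv; have : (0 < crossings u v t)%N.
  apply: leq_trans (crossings_ge u v t).
  by rewrite count_rotor muln_gt0 divn_gt0 ?rotor_pos_lengths // full euv multiplicity_gt0.
rewrite lt0n sum_nat_eq0 => /forallPn[l]; rewrite /= eqb0 negbK => /andP[/eqP<- /eqP<-].
by exists l => //.
Qed.

End Walk.

Local Open Scope ring_scope.

(** * Traces of powers and eigenvalues *)

(** The determinants of (X - B) P and P (X - A) agree, and the nonzero [\det P] cancels. *)
Lemma char_poly_conj (F : fieldType) n (P A B : 'M[F]_n) :
  P \in unitmx -> B *m P = P *m A -> char_poly B = char_poly A.
Proof.
move=> Pu BP; have dP0 : \det (map_mx polyC P) != 0.
  by rewrite det_map_mx /= polyC_eq0 -unitfE -unitmxE.
apply: (mulIf dP0); rewrite -det_mulmx mulrC -det_mulmx.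
by rewrite mulmxBl mulmxBr -!map_mxM BP scalar_mxC.
Qed.

Lemma trig_mxM (F : pzRingType) n (A B : 'M[F]_n) : is_trig_mx A -> is_trig_mx B ->
  is_trig_mx (A *m B) /\ forall i, (A *m B) i i = A i i * B i i.
Proof.
move=> /is_trig_mxP tA /is_trig_mxP tB; split=> [|i].
  apply/is_trig_mxP => i j ij; rewrite mxE big1 // => k _.
  case: (ltnP i k) => [ik|ki]; first by rewrite tA ?mul0r.
  by rewrite tB ?mulr0 //; apply: leq_ltn_trans ij.
rewrite mxE (bigD1 i) //= big1 ?addr0 // => k ki.
case: (ltngtP i k) => [ik|ik|/val_inj ik].
- by rewrite tA ?mul0r.
- by rewrite tB ?mulr0.
- by rewrite ik eqxx in ki.
Qed.

Lemma trig_mxX (F : pzRingType) n (A : 'M[F]_n) k : is_trig_mx A ->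
  is_trig_mx (A ^+ k) /\ forall i, (A ^+ k) i i = A i i ^+ k.
Proof.
move=> tA; elim: k => [|k [tAk Aki]].
  by split=> [|i]; rewrite expr0 ?scalar_mx_is_trig // ?mxE ?eqxx.
have [tS Si] := trig_mxM tA tAk.
by split=> [|i]; rewrite exprS // -mulmxE Si Aki exprS.
Qed.

(** Schur triangularization makes [A] similar to a triangular matrix whose diagonal lists the
    eigenvalues with multiplicity, and powers of a triangular matrix have the powers of its diagonal
    entries on the diagonal. *)
Lemma mxtraceX_eigenvalues (C : numClosedFieldType) n (A : 'M[C]_n) (r : seq C) k :
  char_poly A = \prod_(z <- r) ('X - z%:P) -> \tr (A ^+ k) = \sum_(z <- r) z ^+ k.
Proof.
move=> Ar.
have [|P Punitary /=] := @cotrigonalization C n [:: A].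
  by move=> B D; rewrite !inE => /eqP-> /eqP->.
rewrite andbT.
have Pu := unitarymx_unit Punitary.
rewrite /mxred.similar_to mxred.conjumx //; set T := (X in is_trig_mx X) => tT.
have TP : T *m P = P *m A by rewrite /T -mulmxA mulVmx // mulmx1.
have TkP j : T ^+ j *m P = P *m A ^+ j.
  elim: j => [|j IH]; first by rewrite !expr0 mul1mx mulmx1.
  by rewrite !exprS -!mulmxE -mulmxA IH mulmxA TP mulmxA.
have -> : A ^+ k = invmx P *m (T ^+ k *m P) by rewrite TkP mulKmx.
rewrite mxtrace_mulC -mulmxA mulmxV // mulmx1 /mxtrace.
have [_ Ti] := trig_mxX k tT; rewrite (eq_bigr _ (fun i _ => Ti i)).
have /prod_XsubC_eq rT : \prod_(z <- r) ('X - z%:P) =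
    \prod_(z <- [seq T i i | i : 'I_n]) ('X - z%:P).
  by rewrite big_image /= -char_poly_trig // -Ar (char_poly_conj Pu TP).
by rewrite (perm_big _ rT) big_image.
Qed.

Lemma eigenvaluesE (R : realType) n (A : 'M[R[i]]_n) :
  char_poly A = \prod_(z <- eigenvalues A) ('X - z%:P).
Proof.
rewrite /eigenvalues; case: closed_field_poly_normal => r /= {1}->.
by rewrite (monicP (char_poly_monic A)) scale1r.
Qed.

Lemma size_eigenvalues (R : realType) n (A : 'M[R[i]]_n) : size (eigenvalues A) = n.
Proof.
have := size_char_poly A; rewrite eigenvaluesE size_prod_XsubC => -[].
by [].
Qed.

(** * Moduli of the eigenvalues of real and stochastic matrices *)

Lemma normc_real (R : realType) (x : R) : Normc.normc (x%:C)%C = `|x|.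
Proof. by rewrite /Normc.normc /= expr0n addr0 sqrtr_sqr. Qed.

Lemma normcX (R : realType) (z : R[i]) k : Normc.normc (z ^+ k) = Normc.normc z ^+ k.
Proof.
by elim: k => [|k IH]; rewrite ?expr0 ?Normc.normc1 // !exprS Normc.normcM IH.
Qed.

Lemma normc_sum (R : realType) I (r : seq I) (P : pred I) (F : I -> R[i]) :
  Normc.normc (\sum_(i <- r | P i) F i) <= \sum_(i <- r | P i) Normc.normc (F i).
Proof.
elim/big_rec2: _ => [|i x y _ xy]; first by rewrite Normc.normc0.
by apply: le_trans (le_normcD _ _) _; rewrite lerD2l.
Qed.

Lemma normc_ge0 (R : realType) (z : R[i]) : 0 <= Normc.normc z.
Proof. by case: z => a b; apply: sqrtr_ge0. Qed.

(* The l1 norm of a left eigenvector cannot grow under a stochastic matrix. *)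
Lemma eigenvalue_stochastic (R : realType) n (P : 'M[R]_n) (z : R[i]) :
  (forall i j, 0 <= P i j) -> (forall i, \sum_j P i j = 1) ->
  z \in eigenvalues (map_mx (real_complex R) P) -> Normc.normc z <= 1.
Proof.
move=> P0 P1 zP.
have /eigenvalueP[v vP vn0] : eigenvalue (map_mx (real_complex R) P) z.
  by rewrite eigenvalue_root_char eigenvaluesE root_prod_XsubC.
have vj j : z * v 0 j = \sum_i v 0 i * (P i j)%:C%C.
  move/rowP: vP => /(_ j); rewrite !mxE => <-.
  by apply: eq_bigr => i _; rewrite mxE.
have Sgt0 : 0 < \sum_j Normc.normc (v 0 j).
  rewrite lt_def sumr_ge0 ?andbT => [|j _]; last exact: normc_ge0.
  apply: contra vn0 => /eqP S0; apply/eqP/rowP => j; rewrite mxE.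
  apply: Normc.eq0_normc; apply/eqP.
  by move/eqP: S0; rewrite psumr_eq0 => [/allP/(_ j (mem_index_enum j))|k _]; rewrite ?normc_ge0.
rewrite -(ler_pM2r Sgt0) mul1r mulr_sumr.
under eq_bigr do rewrite -Normc.normcM vj.
apply: (@le_trans _ _ (\sum_j \sum_i Normc.normc (v 0 i) * P i j)).
  apply: ler_sum => j _; apply: le_trans (normc_sum _ _ _) _.
  by apply: ler_sum => i _; rewrite Normc.normcM normc_real ger0_norm.
by rewrite exchange_big ler_sum //= => i _; rewrite -mulr_sumr P1 mulr1.
Qed.

Definition moduli (R : realType) n (P : 'M[R]_n) : seq R :=
  [seq Normc.normc z | z <- eigenvalues (map_mx (real_complex R) P)].

Lemma mxtraceX_moduli (R : realType) n (P : 'M[R]_n) k :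
  \tr (P ^+ k) <= \sum_(x <- moduli P) x ^+ k.
Proof.
apply: le_trans (ler_norm _) _; rewrite -normc_real.
have -> : ((\tr (P ^+ k))%:C)%C = \tr ((map_mx (real_complex R) P) ^+ k).
  have -> : (map_mx (real_complex R) P) ^+ k = map_mx (real_complex R) (P ^+ k).
    elim: k => [|k IH]; first by rewrite !expr0 map_mx1.
    by rewrite !exprS -!mulmxE IH map_mxM.
  by rewrite trace_map_mx.
rewrite (mxtraceX_eigenvalues _ (eigenvaluesE _)) big_map.
by apply: le_trans (normc_sum _ _ _) _; apply: ler_sum => z _; rewrite normcX.
Qed.

(* At most one modulus is larger than the second one, and none exceeds 1. *)
Lemma sum_moduli_le (R : realType) (s : seq R) k :
  {in s, forall x, 0 <= x <= 1} ->
  \sum_(x <- s) x ^+ k <= 1 + (size s).-1%:R * (nth 0 (sort >=%R s) 1) ^+ k.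
Proof.
move=> s01; rewrite -(size_sort >=%R s).
rewrite -(perm_big _ (permEl (perm_sort >=%R s))).
have : {in sort >=%R s, forall x, 0 <= x <= 1} by move=> x; rewrite mem_sort => /s01.
have := sort_sorted (@ge_total _ R) s; case: (sort _ _) => [|a t] /=.
  by rewrite big_nil mul0r addr0.
move=> sorted_t at01; rewrite big_cons lerD //.
  by have /andP[a0 a1] := at01 a (mem_head _ _); rewrite exprn_ile1.
(* With a single entry, the second modulus is the default 0, but its coefficient is 0 as well. *)
case: t sorted_t at01 => [|b t]; first by rewrite big_nil mul0r.
rewrite /= => /andP[_ bt] at01.
have le_b : {in b :: t, forall x, 0 <= x <= b}.
  move=> x xbt; have /andP[x0 _] := at01 x (mem_behead (s := a :: b :: t) xbt).
  rewrite x0 /=; move: xbt; rewrite inE => /predU1P[->//|].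
  have /allP bt' := order_path_min (rev_trans le_trans) bt; exact: bt'.
apply: (@le_trans _ _ (\sum_(x <- b :: t) b ^+ k)).
  rewrite big_seq [leRHS]big_seq; apply: ler_sum => x /le_b/andP[x0 xb].
  by rewrite lerXn2r // nnegrE // (le_trans x0).
by rewrite big_const_seq count_predT iter_addr_0 /= mulr_natl.
Qed.

(** * Reversible stochastic matrices *)

Section ReversibleChain.
Variables (R : realType) (n : nat) (P : 'M[R]_n) (w : 'I_n -> R).
Hypotheses (P_ge0 : forall i j, 0 <= P i j) (P_sum1 : forall i, \sum_j P i j = 1).
Hypotheses (w_gt0 : forall i, 0 < w i).
Hypothesis P_rev : forall i j, w i * P i j = w j * P j i.

Let W := \sum_i w i.

Lemma stochasticX_sum1 k i : \sum_j (P ^+ k) i j = 1.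
Proof.
elim: k i => [|k IH] i.
  rewrite expr0 (bigD1 i) //= big1 ?mxE ?eqxx ?addr0 // => j ij.
  by rewrite mxE eq_sym (negPf ij).
rewrite exprS -mulmxE; under eq_bigr do rewrite mxE.
by rewrite exchange_big -[RHS](P_sum1 i); apply: eq_bigr => l _; rewrite -mulr_sumr IH mulr1.
Qed.

(** In the induction one side splits off the first step of P^(k+1), the other side the last step. *)
Lemma reversibleX k i j : w i * (P ^+ k) i j = w j * (P ^+ k) j i.
Proof.
elim: k i j => [|k IH] i j.
  by rewrite expr0 !mxE [j == i]eq_sym; case: eqP => [->|_]; rewrite ?mulr0.
rewrite {1}exprS exprSr -!mulmxE !mxE !mulr_sumr; apply: eq_bigr => l _.
by rewrite mulrA P_rev [w l * _]mulrC -mulrA IH mulrCA [P l i * _]mulrC.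
Qed.

(* The left-hand side is the squared Hilbert-Schmidt norm, in l2(w), of P^k
   minus the projection on the constants. *)
Lemma sum_sqr_dev (i0 : 'I_n) k :
  \sum_i \sum_j ((P ^+ k) i j - w j / W) ^+ 2 * (w i / w j) = \tr (P ^+ (k + k)) - 1.
Proof.
have W0 : W != 0.
  by rewrite gt_eqF // /W (bigD1 i0) //= ltr_pwDl // sumr_ge0 // => i _; apply: ltW.
(* Reversibility turns the weighted square into P^k(i,j) P^k(j,i) plus two correction terms. The
   products sum to the trace of P^(2k), the corrections to -2 and +1. *)
have E i j : ((P ^+ k) i j - w j / W) ^+ 2 * (w i / w j) =
    (P ^+ k) i j * (P ^+ k) j i - w i / W * (P ^+ k) i j *+ 2 + w i / W * (w j / W).
  have -> : (P ^+ k) j i = w i * (P ^+ k) i j / w j.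
    by rewrite reversibleX mulrAC mulfV ?mul1r // gt_eqF.
  by have := w_gt0 j; move/lt0r_neq0 => wj; field; rewrite W0 wj.
under eq_bigr do (under eq_bigr do rewrite E); rewrite /mxtrace.
have -> : \sum_i (P ^+ (k + k)) i i = \sum_i \sum_j (P ^+ k) i j * (P ^+ k) j i.
  by apply: eq_bigr => i _; rewrite exprD -mulmxE mxE.
have W1 : \sum_i w i / W = 1 by rewrite -mulr_suml mulfV.
transitivity (\sum_i (\sum_j (P ^+ k) i j * (P ^+ k) j i - w i / W)).
  apply: eq_bigr => i _; rewrite big_split sumrB /= sumrMnl -!mulr_sumr.
  by rewrite stochasticX_sum1 W1 mulr1 mulr2n; ring.
by rewrite sumrB W1.
Qed.

Lemma sqr_dev_le (i j : 'I_n) k :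
  ((P ^+ k) i j - w j / W) ^+ 2 * (w i / w j) <= \tr (P ^+ (k + k)) - 1.
Proof.
rewrite -(sum_sqr_dev i k) (bigD1 i) //= (bigD1 j) //= -addrA lerDl.
have t0 a b : 0 <= ((P ^+ k) a b - w b / W) ^+ 2 * (w a / w b).
  by rewrite mulr_ge0 ?sqr_ge0 ?divr_ge0 // ltW.
by apply: addr_ge0; apply: sumr_ge0 => a _ //; apply: sumr_ge0.
Qed.

Let lam := nth 0 (sort >=%R (moduli P)) 1.

Lemma moduli_itv : {in moduli P, forall x, 0 <= x <= 1}.
Proof.
move=> _ /mapP[z zP ->]; rewrite normc_ge0.
exact: eigenvalue_stochastic zP.
Qed.

Lemma lam_itv : 0 <= lam <= 1.
Proof.
rewrite /lam; have [lt1|] := ltnP 1 (size (sort >=%R (moduli P))).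
  by apply: moduli_itv; rewrite -(mem_sort >=%R) mem_nth.
by move/(nth_default 0) ->; rewrite lexx ler01.
Qed.

(** The trace bound gives dev^2 w_i / w_j <= n lam^(2k). As w_i >= 1 and w_j <= n, the deviation
    from w_j / W is at most n lam^k <= 1 / (2 W), hence at most half of w_j / W. *)
Lemma reversible_mixing (i j : 'I_n) k :
  (forall i, 1 <= w i <= n%:R) -> n%:R * lam ^+ k <= (2 * W)^-1 ->
  w j / W / 2 <= (P ^+ k) i j.
Proof.
move=> w1n mix.
have W0 : 0 < W.
  by rewrite /W (bigD1 i) //= ltr_pwDl // sumr_ge0 // => a _; apply: ltW.
have /andP[lam0 _] := lam_itv.
have sqle : ((P ^+ k) i j - w j / W) ^+ 2 <= (n%:R * lam ^+ k) ^+ 2.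
  have := le_trans (sqr_dev_le i j k) (lerB (mxtraceX_moduli P (k + k)) (lexx 1)).
  have := sum_moduli_le (k + k) moduli_itv.
  rewrite -/lam /moduli size_map size_eigenvalues -/(moduli P) => le1 le2.
  have {le1 le2} : ((P ^+ k) i j - w j / W) ^+ 2 * (w i / w j) <= n%:R * lam ^+ (k + k).
    apply: (@le_trans _ _ (n.-1%:R * lam ^+ (k + k))); first by lra.
    by rewrite ler_wpM2r ?exprn_ge0 // ler_nat leq_pred.
  have /andP[wi1 _] := w1n i; have /andP[wj1 wjn] := w1n j.
  have wj0 := w_gt0 j; have wi0 := w_gt0 i.
  rewrite mulrA ler_pdivrMr // => h.
  apply: (@le_trans _ _ (((P ^+ k) i j - w j / W) ^+ 2 * w i)).
    by rewrite ler_peMr // sqr_ge0.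
  apply: le_trans h _; rewrite exprD exprMn expr2 -!mulrA ler_wpM2l //.
  by rewrite mulrA mulrC -expr2 ler_wpM2r // sqr_ge0.
have nl0 : 0 <= n%:R * lam ^+ k by rewrite mulr_ge0 // exprn_ge0.
have dev_ge : - (n%:R * lam ^+ k) <= (P ^+ k) i j - w j / W.
  by rewrite leNgt; apply/negP => ?; move: sqle; apply/negP; rewrite -ltNge; nra.
have : (2 * W)^-1 <= w j / W / 2.
  have /andP[wj1 _] := w1n j.
  by rewrite invfM mulrC ler_pM2r ?invr_gt0 // ler_pdivlMr // mulVf ?gt_eqF.
by lra.
Qed.

(** [P] is monotone, having nonnegative entries, and fixes constants; so each further step costs one
    more [G]. *)
Lemma subharmonicX (a : 'I_n -> R) G k i :
  (forall i, \sum_j P i j * a j <= a i + G) ->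
  \sum_j (P ^+ k) i j * a j <= a i + k%:R * G.
Proof.
move=> aG; elim: k i => [|k IH] i.
  rewrite expr0 (bigD1 i) //= big1 ?mxE ?eqxx ?mul1r ?mul0r // => j ij.
  by rewrite mxE eq_sym (negPf ij) mul0r.
rewrite exprS -mulmxE; under eq_bigr do rewrite mxE mulr_suml.
rewrite exchange_big /=.
apply: (@le_trans _ _ (\sum_l P i l * (a l + k%:R * G))).
  apply: ler_sum => l _; under eq_bigr do rewrite -mulrA.
  by rewrite -mulr_sumr ler_wpM2l.
under eq_bigr do rewrite mulrDr; rewrite big_split /= -mulr_suml P_sum1 mul1r.
by rewrite mulrSr mulrDl mul1r addrA addrAC lerD2r.
Qed.

End ReversibleChain.

(** * Edge cover time *)

Lemma sum_enum_val (R : nmodType) (T : finType) (F : T -> R) :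
  \sum_(i < #|T|) F (enum_val i) = \sum_u F u.
Proof. by rewrite -big_enum_val. Qed.

Section Graph.
Variables (R : realType) (T : finType) (e : rel T).
Hypotheses (e_sym : symmetric e) (deg_gt0 : forall u, (0 < deg e u)%N).

Let n := #|T|.
Let P := srw_matrix R e.
Let w (i : 'I_n) : R := (deg e (enum_val i))%:R.
Let W : R := \sum_u (deg e u)%:R.

Lemma srw_ge0 i j : 0 <= P i j.
Proof. by rewrite mxE; case: ifP => // _; rewrite invr_ge0. Qed.

Lemma sum_srw (a : T -> R) i :
  \sum_j P i j * a (enum_val j) =
  (\sum_(v | e (enum_val i) v) a v) / (deg e (enum_val i))%:R.
Proof.
rewrite mulr_suml [RHS]big_mkcond -[RHS]sum_enum_val /=; apply: eq_bigr => j _.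
by rewrite mxE; case: ifP => _; rewrite ?mul0r // mulrC.
Qed.

Lemma srw_sum1 i : \sum_j P i j = 1.
Proof.
have := sum_srw (fun=> 1) i; rewrite sumr_const -/(deg e _) mulfV ?pnatr_eq0 -?lt0n //.
by move=> <-; apply: eq_bigr => j _; rewrite mulr1.
Qed.

Lemma srw_rev i j : w i * P i j = w j * P j i.
Proof.
rewrite !mxE e_sym; case: ifP => _; rewrite ?mulr0 // !mulfV // pnatr_eq0 -lt0n //.
Qed.

Lemma lambda2_itv : 0 <= lambda2 R e <= 1.
Proof. exact: lam_itv srw_ge0 srw_sum1. Qed.

Section Walk.
Variables (d : T -> nat) (s : rotor_lists d) (r0 : rotor_positions d) (x0 : T).
Hypothesis rotor_s : rotor_sequences e s.

Lemma length_over_deg u : (d u)%:R / (deg e u)%:R = (d u %/ deg e u)%:R :> R.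
Proof.
by rewrite {1}(rotor_length rotor_s) natrM mulfK // pnatr_eq0 -lt0n.
Qed.

Lemma multiplicity_le_kappa u : (d u %/ deg e u)%:R <= kappa e d R.
Proof. by rewrite -length_over_deg; apply: (le_bigmax _ (fun u => (d u)%:R / (deg e u)%:R)). Qed.

Lemma kappa_ge1 : 1 <= kappa e d R.
Proof.
by apply: le_trans (multiplicity_le_kappa x0); rewrite ler1n (multiplicity_gt0 r0 rotor_s).
Qed.

Let a t u : R := (exits s r0 x0 u t)%:R / (deg e u)%:R.

(* The flow along each edge follows its expected value up to kappa, and flow is
   conserved up to the two endpoints of the trajectory. *)
Lemma exits_subharmonic t i :
  \sum_j P i j * a t (enum_val j) <= a t (enum_val i) + 2 * kappa e d R.
Proof.
rewrite sum_srw; set u := enum_val i; have k1 := kappa_ge1.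
have du : 1 <= (deg e u)%:R :> R by rewrite ler1n.
rewrite ler_pdivrMr ?(lt_le_trans ltr01) //.
apply: (@le_trans _ _ (\sum_(v | e u v) ((crossings s r0 x0 v u t)%:R + kappa e d R))).
  apply: ler_sum => v euv; rewrite /a ler_pdivrMr ?ltr0n //.
  have evu : e v u by rewrite e_sym.
  have := exits_le r0 x0 rotor_s t evu; rewrite -(ler_nat R) natrM natrD => h.
  by apply: le_trans h _; rewrite ler_wpM2r // lerD2l multiplicity_le_kappa.
rewrite big_split sumr_const -/(deg e u) /=.
have : \sum_(v | e u v) (crossings s r0 x0 v u t)%:R <= (exits s r0 x0 u t)%:R + 1 :> R.
  rewrite natr1; have := sum_crossings_le s r0 x0 u t; rewrite -(ler_nat R) natr_sum.
  apply: le_trans; rewrite big_mkcond /=; apply: ler_sum => v _.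
  by case: ifP.
(* One kappa per edge comes from the rotors; the second one absorbs the endpoint term 1, since kappa
   and the degree are at least 1. *)
have -> : (a t u + 2 * kappa e d R) * (deg e u)%:R =
    (exits s r0 x0 u t)%:R + 2 * (kappa e d R * (deg e u)%:R).
  by rewrite mulrDl mulrA divfK // pnatr_eq0 -lt0n.
rewrite -[kappa e d R *+ _]mulr_natr; nra.
Qed.

Lemma exits_ge_length k t u :
  n%:R * lambda2 R e ^+ k <= (2 * W)^-1 ->
  2 * W * ((2 * k%:R + 1) * kappa e d R) <= t%:R ->
  (d u <= exits s r0 x0 u t)%N.
Proof.
move=> mix le_t.
have W_enum : W = \sum_i w i by rewrite /W -[LHS]sum_enum_val.
have w_gt0 i : 0 < w i by rewrite ltr0n.
have w_itv i : 1 <= w i <= n%:R by rewrite ler1n deg_gt0 ler_nat max_card.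
have W_gt0 : 0 < W.
  by rewrite /W (bigD1 u) //= ltr_pwDl ?ltr0n // sumr_ge0.
have := subharmonicX srw_ge0 srw_sum1 k (enum_rank u) (exits_subharmonic t).
rewrite enum_rankK.
have : t%:R / (2 * W) <= \sum_j (P ^+ k) (enum_rank u) j * a t (enum_val j).
  (* The weight [w j] cancels the degree in [a t], and the exits from all vertices add up to [t]. *)
  have -> : t%:R / (2 * W) = \sum_j w j / W / 2 * a t (enum_val j).
    rewrite -[in LHS](sum_exits s r0 x0 t) natr_sum mulr_suml -sum_enum_val.
    apply: eq_bigr => j _; rewrite /a /w.
    have := deg_gt0 (enum_val j); rewrite lt0n -(pnatr_eq0 R) => dj.
    by field; rewrite dj gt_eqF.
  apply: ler_sum => j _; rewrite ler_wpM2r ?divr_ge0 // W_enum.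
  by apply: (reversible_mixing srw_ge0 srw_sum1 w_gt0 srw_rev); rewrite -?W_enum.
move=> le1 le2; have {le1 le2} le_a := le_trans le1 le2.
(* Removing the accumulated error 2 k kappa leaves a lower bound kappa on [a t u], and kappa is at
   least d(u) / deg(u). *)
have : (2 * k%:R + 1) * kappa e d R <= t%:R / (2 * W).
  by rewrite ler_pdivlMr ?mulr_gt0 // mulrC.
move=> le1; have : kappa e d R <= a t u by lra.
move/(le_trans (multiplicity_le_kappa u)); rewrite -length_over_deg /a.
by rewrite ler_pM2r ?invr_gt0 ?ltr0n // ler_nat.
Qed.

End Walk.
End Graph.

(** * Elementary bounds on degrees *)

(** A path from [u] to another vertex begins with an edge at [u]. *)
Lemma connected_deg_gt0 (T : finType) (e : rel T) : connected_graph e ->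
  (1 < #|T|)%N -> forall u, (0 < deg e u)%N.
Proof.
move=> [_ conn] T2 u.
have /card_gt0P[v] : (0 < #|[pred v | v != u]|)%N.
  by have := cardC1 u; rewrite (eq_card (B := [pred v | v != u])) // => ->; case: #|T| T2 => [|[]].
rewrite inE => vu; have /connectP[[|y p] /=] := conn u v.
  by move=> _ vE; rewrite vE eqxx in vu.
by case/andP=> euy _ _; apply/card_gt0P; exists y.
Qed.

Lemma deg_le_max_deg (T : finType) (e : rel T) u : (deg e u <= max_deg e)%N.
Proof. exact: (leq_bigmax u). Qed.

Lemma min_deg_le_deg (T : finType) (e : rel T) u : (min_deg e <= deg e u)%N.
Proof.
rewrite /min_deg; elim: (index_enum T) (mem_index_enum u) => [//|v r IH].
by rewrite inE big_cons geq_min => /predU1P[<-|/IH ->]; rewrite ?leqnn ?orbT.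
Qed.

Lemma min_deg_gt0 (T : finType) (e : rel T) : (0 < #|T|)%N ->
  (forall u, (0 < deg e u)%N) -> (0 < min_deg e)%N.
Proof.
by move=> T0 d0; rewrite /min_deg; elim/big_ind: _ => // a b; rewrite leq_min => -> ->.
Qed.

(** * Choice of the number of steps and of the time *)

(** This is 1 + y <= exp y at y = x - 1, raised to the power [k]. *)
Lemma exprn_le_expR (R : realType) (x : R) k :
  0 <= x -> x ^+ k <= expR (k%:R * - (1 - x)).
Proof.
move=> x0; rewrite expRM_natl lerXn2r ?nnegrE ?expR_ge0 //.
by apply: le_trans (expR_ge1Dx _); lra.
Qed.

(** The upper bound allows natural logarithms to be replaced by base 2 logarithms. *)
Lemma ln2_itv (R : realType) : 0 < ln (2 : R) <= 1.
Proof.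
rewrite ln_gt0 ?ltr1n //= -ler_expR lnK ?posrE //.
by apply: le_trans (expR_ge1Dx _); lra.
Qed.

(** Take [k] just above 4 ln n / (1 - lam) and [t] just above 2 W (2k + 1) K. *)
Lemma exists_mixing_time (R : realType) (n : nat) (lam W K : R) :
  (1 < n)%N -> 0 <= lam < 1 -> 1 <= W <= n%:R * n%:R -> 1 <= K ->
  exists k t : nat, [/\ n%:R * lam ^+ k <= (2 * W)^-1,
    2 * W * ((2 * k%:R + 1) * K) <= t%:R &
    t%:R <= 23 * (W * K * (log2 n%:R / (1 - lam)))].
Proof.
move=> n2 /andP[lam0 lam1] /andP[W1 Wn] K1.
have gap0 : 0 < 1 - lam by rewrite subr_gt0.
have n0 : 0 < n%:R :> R by rewrite ltr0n ltnW.
have n2R : 2 <= n%:R :> R by rewrite ler_nat.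
have /andP[l20 l21] := ln2_itv R.
have lnn0 : 0 <= ln n%:R :> R by rewrite ln_ge0 // ler1n ltnW.
set L := log2 n%:R / (1 - lam).
have log1 : 1 <= log2 n%:R :> R by rewrite /log2 ler_pdivlMr // mul1r ler_ln ?posrE.
have L1 : 1 <= L by rewrite /L ler_pdivlMr //; lra.
have lnL : ln n%:R / (1 - lam) <= L.
  by rewrite ler_pM2r ?invr_gt0 // /log2 ler_pdivlMr // ler_piMr.
(* The factor 4 makes lam^k at most n^-4. *)
set y := 4 * (ln n%:R / (1 - lam)).
have y0 : 0 <= y by rewrite mulr_ge0 // divr_ge0 // ltW.
have /andP[k1 k2] := truncn_itv y0; set k0 := Num.trunc y in k1 k2.
pose k := k0.+1.
pose X := 2 * W * ((2 * k%:R + 1) * K).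
have X0 : 0 <= X.
  by apply: mulr_ge0; [|apply: mulr_ge0; [apply: addr_ge0|]]; rewrite ?mulr_ge0 //; lra.
have /andP[t1 t2] := truncn_itv X0; set t0 := Num.trunc X in t1 t2.
exists k, t0.+1; split.
- have lamk : lam ^+ k <= (n%:R ^+ 4)^-1.
    apply: le_trans (exprn_le_expR _ lam0) _.
    rewrite -[n%:R in leRHS]lnK ?posrE // -expRM_natl -expRN ler_expR mulrN lerN2.
    by rewrite -ler_pdivrMr // -mulrA ltW.
  have n40 : 0 < n%:R ^+ 4 :> R by rewrite exprn_gt0.
  (* It remains that 2 W <= n^3, which follows from W <= n^2 and n >= 2. *)
  apply: (@le_trans _ _ (n%:R / n%:R ^+ 4)); first by rewrite ler_wpM2l // ltW.
  rewrite ler_pdivrMr // mulrC ler_pdivlMr; last by lra.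
  have : n%:R * n%:R * (n%:R * n%:R) = n%:R ^+ 4 :> R by ring.
  by nra.
- exact: ltW.
(* Since k <= 4 L + 1 and L >= 1, 2k + 1 <= 8 L + 3 <= 11 L, whence 22. Rounding [t] up adds at most
   1 <= W K L, whence 23. *)
- have Xle : X <= 22 * (W * K * L).
    rewrite /X; have kL : 2 * k%:R + 1 <= 11 * L by rewrite /k -natr1; rewrite /y in k1; lra.
    have WK : 0 <= W * K by nra.
    have -> : 2 * W * ((2 * k%:R + 1) * K) = 2 * (W * K) * (2 * k%:R + 1) by ring.
    have -> : 22 * (W * K * L) = 2 * (W * K) * (11 * L) by ring.
    by rewrite ler_wpM2l // mulr_ge0.
  have WK1 : 1 <= W * K by nra.
  have WKL : 1 <= W * K * L by nra.
  by rewrite -natr1; lra.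
Qed.

(** One covering time bounds the infimum; the sum of degrees W is then replaced by n Delta. *)
Lemma edge_cover_time_le (R : realType) (T : finType) (e : rel T) (d : T -> nat)
    (s : rotor_lists d) (r0 : rotor_positions d) (x0 : T) :
  symmetric e -> connected_graph e -> (1 < #|T|)%N -> lambda2 R e < 1 ->
  rotor_sequences e s ->
  (edge_cover_time e R s r0 x0 <=
   (23 * (#|T|%:R * (max_deg e)%:R * kappa e d R *
     (log2 #|T|%:R / (1 - lambda2 R e))))%:E)%E.
Proof.
move=> e_sym conn T2 lam1 rotor_s; have d0 := connected_deg_gt0 conn T2.
have /andP[lam0 _] := lambda2_itv R d0.
pose W : R := \sum_u (deg e u)%:R.
have K1 : 1 <= kappa e d R := kappa_ge1 R d0 r0 x0 rotor_s.
have W1 : 1 <= W.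
  by rewrite /W (bigD1 x0) //= ler_wpDr ?sumr_ge0 // ler1n d0.
have Wn : W <= #|T|%:R * (max_deg e)%:R.
  apply: (@le_trans _ _ (\sum_(u : T) (max_deg e)%:R)).
    by apply: ler_sum => u _; rewrite ler_nat deg_le_max_deg.
  by rewrite sumr_const mulr_natl.
have Dn : (max_deg e)%:R <= #|T|%:R :> R.
  by rewrite ler_nat; apply/bigmax_leqP => u _; exact: max_card.
have W_itv : 1 <= W <= #|T|%:R * #|T|%:R.
  by rewrite W1 (le_trans Wn) // ler_wpM2l.
have lam_itv : 0 <= lambda2 R e < 1 by rewrite lam0.
have [k [t [mix le_t t_le]]] := exists_mixing_time T2 lam_itv W_itv K1.
apply: ge_ereal_inf; exists (t%:R)%:E.
  exists t => //; apply: traversed_edge_set => // u.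
  exact: (exits_ge_length e_sym d0 r0 x0 rotor_s u mix le_t).
rewrite lee_fin (le_trans t_le) // ler_wpM2l // ler_wpM2r //.
  rewrite divr_ge0 ?subr_ge0 ?(ltW lam1) // /log2 divr_ge0 //.
    by rewrite ln_ge0 // ler1n ltnW.
  by have /andP[/ltW] := ln2_itv R.
by rewrite ler_wpM2r // (le_trans ler01).
Qed.

(** * Maximum over configurations and the final bound *)

Local Open Scope ereal_scope.

(** The nested maxima start at 0, so [B] has to be nonnegative. *)
Lemma max_edge_cover_time_le (R : realType) (T : finType) (e : rel T) (d : T -> nat)
    (B : \bar R) : 0 <= B ->
  (forall (s : rotor_lists d) r0 x0, rotor_sequences e s -> edge_cover_time e R s r0 x0 <= B) ->
  max_edge_cover_time e d R <= B.
Proof.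
move=> B0 le_B; do 3!(apply: bigmax_le => // ? ?).
exact: le_B.
Qed.

Theorem theorem3p10 (R : realType) :
  exists C : R, forall (T : finType) (e : rel T) (d : T -> nat),
    symmetric e -> irreflexive e -> connected_graph e ->
    let n : R := #|T|%:R%R in
    let delta : R := (min_deg e)%:R%R in
    let Delta : R := (max_deg e)%:R%R in
    let gap : R := (1 - lambda2 R e)%R in
    max_edge_cover_time e d R <=
      C%:E * ((Delta / delta)%:E * (n%:E / gap%:E) +
              (n * kappa e d R * (Delta / delta))%:E *
                ((Delta * log2 n)%:E / gap%:E)).
Proof.
exists 23%R => T e d e_sym e_irr conn; cbv zeta.
set n : R := (#|T|%:R)%R; set delta : R := ((min_deg e)%:R)%R.
set Delta : R := ((max_deg e)%:R)%R; set gap : R := (1 - lambda2 R e)%R.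
have K0 : (0 <= kappa e d R)%R by exact: bigmax_ge_id.
(* On one vertex the degree is 0, and a rotor sequence would have multiplicity 0, so no
   configuration is admissible; both sides are 0. *)
have [T1|T2] := leqP #|T| 1.
  have T1' : #|T| = 1%N by apply/eqP; rewrite eqn_leq T1 conn.1.
  have e0 u v : e u v = false.
    by have /fintype_le1P/(_ u v) -> := T1; rewrite e_irr.
  have Delta0 : Delta = 0%R.
    rewrite /Delta /max_deg big1 // => u _; apply: eq_card0 => v.
    by rewrite inE e0.
  rewrite Delta0 !mul0r mulr0 !mul0e adde0 mule0.
  apply: max_edge_cover_time_le => // s r0 x0 rotor_s.
  by have := multiplicity_gt0 r0 rotor_s x0; rewrite /deg eq_card0 ?divn0 // => v; rewrite inE e0.
have d0 := connected_deg_gt0 conn T2.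
have /card_gt0P[u0 _] : (0 < #|T|)%N := ltnW T2.
have delta0 : (0 < delta)%R by rewrite ltr0n min_deg_gt0 // ltnW.
have delta_le : (delta <= Delta)%R.
  by rewrite ler_nat (leq_trans (min_deg_le_deg e u0)) ?deg_le_max_deg.
have Delta0 : (0 < Delta)%R := lt_le_trans delta0 delta_le.
have ratio1 : (1 <= Delta / delta)%R by rewrite ler_pdivlMr // mul1r.
have n0 : (0 < n)%R by rewrite ltr0n ltnW.
have log0 : (0 <= log2 n)%R.
  by rewrite /log2 divr_ge0 ?ln_ge0 ?ler1n ?(ltnW T2).
(* If the gap is 0, as for bipartite graphs, its extended inverse is [+oo]. The first summand is
   then [+oo] and the second is nonnegative, so the bound is [+oo]. *)
have /andP[lam0] := lambda2_itv R d0; rewrite le_eqVlt => /predU1P[lam1|lam1].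
  have -> : gap = 0%R by rewrite /gap lam1 subrr.
  rewrite inve0 [X in _ * (_ * X + _)]gt0_muley ?lte_fin //.
  rewrite [X in _ * (X + _)]gt0_muley ?lte_fin ?(lt_le_trans ltr01) //.
  rewrite addye; last first.
    rewrite gt_eqF // (@lt_le_trans _ _ 0) // !mule_ge0 ?leey ?lee_fin //.
    - by rewrite mulr_ge0 ?(le_trans ler01 ratio1) // mulr_ge0 // ltW.
    - by rewrite mulr_ge0 // ltW.
  by rewrite gt0_muley ?leey // lte_fin.
have gap0 : (0 < gap)%R by rewrite subr_gt0.
have gapn0 : gap != 0%R by rewrite gt_eqF.
rewrite inver (negPf gapn0) -!EFinM.
have B0 : (0 <= n * Delta * kappa e d R * (log2 n / gap))%R.
  by rewrite mulr_ge0 ?(divr_ge0 log0 (ltW gap0)) ?mulr_ge0 ?(ltW n0) ?(ltW Delta0).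
apply: (@le_trans _ _ (23 * (n * Delta * kappa e d R * (log2 n / gap)))%:E).
  apply: max_edge_cover_time_le => [|s r0 x0 rotor_s]; first by rewrite lee_fin mulr_ge0.
  exact: edge_cover_time_le.
rewrite lee_fin ler_wpM2l //.
(* The second summand is Delta / delta >= 1 times the bound just obtained, and the first summand is
   nonnegative. *)
have -> : (n * kappa e d R * (Delta / delta) * (Delta * log2 n / gap) =
    Delta / delta * (n * Delta * kappa e d R * (log2 n / gap)))%R.
  by field; rewrite gapn0 gt_eqF.
apply: ler_wpDl; first by rewrite mulr_ge0 ?divr_ge0 // ltW.
by rewrite ler_peMl.
Qed.
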